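(* Every algorithm solving the $(\epsilon,\delta)$-winner determination problem needs $\Omega\!\left(\frac{\log m}{\epsilon^2}\cdot(1-\delta)\right)$ samples for the approval, Borda, and Bucklin voting rules and for every Condorcet consistent voting rule, and needs $\Omega\!\left(\frac{\log k}{\epsilon^2}\cdot(1-\delta)\right)$ samples for the $k$-approval voting rule.
   Context: An election consists of $n$ voters and a set $\mathcal{C}$ of $m$ candidates; each vote is a complete linear order over $\mathcal{C}$ (for approval voting, each voter approves a subset of candidates, and the candidate approved by most voters wins). A voting rule outputs a single winner (ties broken by an arbitrary fixed rule). $k$-approval: a candidate gets one point from each vote placing it among the top $k$ positions; maximum score wins. Borda: a candidate in position $i$ gets $m-i$ points; maximum total wins. Bucklin: the score of $x$ is the minimum $l$ such that more than half of the voters rank $x$ in their top $l$ positions; the lowest score wins. For candidates $x,y$, $D(x,y)=N(x,y)-N(y,x)$ where $N(x,y)$ is the number of voters preferring $x$ to $y$; $x$ is a Condorcet winner if $D(x,y)>0$ for all $y\neq x$; a rule is Condorcet consistent if it selects the Condorcet winner whenever one exists. The margin of victory (MOV) is the smallest number of votes that must be changed (others kept unchanged) to change the winner. The $(\epsilon,\delta)$-winner determination problem: given a voting rule and $n$ votes with MOV at least $\epsilon n$, output the winner with probability at least $1-\delta$ over the algorithm's internal randomness; the algorithm may query full votes of arbitrary voters, and the sample complexity is the number of queried votes.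
   Formalization: For k-approval, k ≤ γm is assumed for a fixed γ<1 (constants depend on γ), since the claim fails for k near m, e.g. k=m−1. Ω is read as: ε small, n large, and (1−δ)log m (resp. (1−δ)log k) at least a constant. *)

(* Defs.v *)
From HB Require Import structures.
From mathcomp Require Import all_boot all_order all_algebra all_fingroup.
From mathcomp Require Import all_classical all_reals all_analysis.

Set Implicit Arguments.
Unset Strict Implicit.
Unset Printing Implicit Defensive.

Import Order.TTheory GRing.Theory Num.Theory.
Local Open Scope ring_scope.

(* An election with n voters, candidates 'I_m and ballots in B. *)
Definition profile (B : finType) (n : nat) : Type := {ffun 'I_n -> B}.

Definition voting_rule (B : finType) (n m : nat) : Type :=
  profile B n -> 'I_m.

(* A ranked vote s : 'S_m sends each candidate to its position, counted from 0:
   the voter prefers x to y when s x < s y, and has x in the top l positions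
   when s x < l. *)

(* A scoring rule is any function that picks one of the candidates with an
   optimal score: no assumption is made on how ties are broken. *)
Definition maximizes (B : finType) (n m : nat)
    (score : profile B n -> 'I_m -> nat) (r : voting_rule B n m) : Prop :=
  forall v x, (score v x <= score v (r v))%N.

Definition minimizes (B : finType) (n m : nat)
    (score : profile B n -> 'I_m -> nat) (r : voting_rule B n m) : Prop :=
  forall v x, (score v (r v) <= score v x)%N.

Definition approval_score (n m : nat) (v : profile {set 'I_m} n) (x : 'I_m)
    : nat :=
  #|[set i | x \in v i]|.

Definition top_count (n m : nat) (v : profile 'S_m n) (l : nat)
    (x : 'I_m) : nat :=
  #|[set i | (v i x < l)%N]|.

Definition k_approval_score (k n m : nat) (v : profile 'S_m n)
    (x : 'I_m) : nat :=
  top_count v k x.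

(* Position p (counted from 0) is worth m - (p + 1) points. *)
Definition borda_score (n m : nat) (v : profile 'S_m n) (x : 'I_m)
    : nat :=
  (\sum_(i < n) (m - (v i x).+1))%N.

(* As soon as n > 0 the value l = m qualifies, so the default is harmless. *)
Definition bucklin_score (n m : nat) (v : profile 'S_m n) (x : 'I_m)
    : nat :=
  \big[minn/m]_(l < m.+1 | (n < 2 * top_count v l x)%N) (l : nat).

Definition approval_rule (n m : nat) (r : voting_rule {set 'I_m} n m) : Prop :=
  maximizes (@approval_score n m) r.

Definition k_approval_rule (k n m : nat) (r : voting_rule 'S_m n m)
    : Prop :=
  maximizes (@k_approval_score k n m) r.

Definition borda_rule (n m : nat) (r : voting_rule 'S_m n m) : Prop :=
  maximizes (@borda_score n m) r.

Definition bucklin_rule (n m : nat) (r : voting_rule 'S_m n m) : Prop :=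
  minimizes (@bucklin_score n m) r.

Definition prefer_count (n m : nat) (v : profile 'S_m n) (x y : 'I_m)
    : nat :=
  #|[set i | (v i x < v i y)%N]|.

Definition pairwise_margin (n m : nat) (v : profile 'S_m n)
    (x y : 'I_m) : int :=
  (prefer_count v x y)%:Z - (prefer_count v y x)%:Z.

Definition condorcet_winner (n m : nat) (v : profile 'S_m n) (x : 'I_m)
    : Prop :=
  forall y, y != x -> 0 < pairwise_margin v x y.

Definition condorcet_consistent (n m : nat) (r : voting_rule 'S_m n m)
    : Prop :=
  forall v x, condorcet_winner v x -> r v = x.

(* The default n.+1 plays the role of infinity: it is only reached when no
   change of the votes changes the winner. *)
Definition margin_of_victory (B : finType) (n m : nat) (r : voting_rule B n m)
    (v : profile B n) : nat :=
  \big[minn/n.+1]_(w : {ffun 'I_n -> B} | r w != r v) #|[set i | w i != v i]|.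

(* Deterministic adaptive strategies: the next query depends on the votes seen. *)
Inductive query_tree (B : finType) (n m : nat) : Type :=
| Output of 'I_m
| Query of 'I_n & (B -> query_tree B n m).

Fixpoint run (B : finType) (n m : nat) (t : query_tree B n m)
    (v : profile B n) : 'I_m :=
  match t with
  | Output x => x
  | Query i next => run (next (v i)) v
  end.

Fixpoint queried (B : finType) (n m : nat) (t : query_tree B n m)
    (v : profile B n) : {set 'I_n} :=
  match t with
  | Output _ => finset.set0
  | Query i next => (i |: queried (next (v i)) v)%SET
  end.

(* The internal randomness is drawn from an arbitrary probability space and
   selects the query strategy. *)
Record algorithm (R : realType) (B : finType) (n m : nat) := Algorithm {
  seed_display : measure_display;
  seed : measurableType seed_display;
  seed_law : probability seed R;
  strategy : seed -> query_tree B n m;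
  measurable_run : forall (v : profile B n) (x : 'I_m),
    measurable [set w | run (strategy w) v = x]%classic
}.

Definition promise (R : realType) (B : finType) (n m : nat)
    (r : voting_rule B n m) (eps : R) (v : profile B n) : bool :=
  eps * n%:R <= (margin_of_victory r v)%:R.

Definition solves_winner_determination (R : realType) (B : finType)
    (n m : nat) (r : voting_rule B n m) (eps delta : R)
    (A : algorithm R B n m) : Prop :=
  forall v, promise r eps v ->
    ((1 - delta)%:E <= seed_law A [set w | run (strategy w) v = r v]%classic)%E.

(* The largest number of distinct votes queried, over the elections satisfying
   the promise and over the internal randomness. *)
Definition sample_complexity (R : realType) (B : finType) (n m : nat)
    (r : voting_rule B n m) (eps : R) (A : algorithm R B n m) : nat :=
  \max_(v : {ffun 'I_n -> B} | promise r eps v)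
    \max_(s < n.+1 | `[< exists w : seed A, #|queried (strategy w) v| = s >])
      (s : nat).

Definition needs_samples (R : realType) (B : finType) (n m : nat)
    (r : voting_rule B n m) (eps delta bound : R) : Prop :=
  forall A : algorithm R B n m, solves_winner_determination r eps delta A ->
    bound <= (sample_complexity r eps A)%:R.

(* Main.v *)
Require Import Defs.
From HB Require Import structures.
From mathcomp Require Import all_boot all_order all_algebra all_fingroup.
From mathcomp Require Import all_classical all_reals all_analysis.
From mathcomp Require Import measurable_realfun ring lra zify.

Set Implicit Arguments.
Unset Strict Implicit.
Unset Printing Implicit Defensive.

Import Order.TTheory GRing.Theory Num.Theory.
Local Open Scope ring_scope.

(* Fano's method. The n ballots are drawn independently, either from a base law
   Q, or, for a candidate x of a large set X, from the tilted law
   Q * (1 + a * phi x), where |phi x| <= 1, phi x has mean 0 under Q, and a is a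
   constant times eps. Each query discloses at most
   chi^2 <= a^2 of information about x, so an algorithm reading s votes finds x
   with probability at most (s * a^2 + 1) / ln #|X| on average over x. On the other
   hand, under the law of x the score gaps between x and the other candidates
   exceed their variation under eps * n changes of votes, with probability at
   least 1/2 for large n: x is then the winner with margin at least eps * n, and
   the algorithm must output it with probability at least 1 - delta. Hence
   (1 - delta) / 2 * ln #|X| <= s * a^2 + 1. *)

(** * Expectations over independent ballots *)

Section Distributions.
Variables (R : realType) (B : finType).
Implicit Types (Q M rho : B -> R).

Definition is_dist Q := (forall b, 0 <= Q b) /\ \sum_b Q b = 1.

Definition prod_ex (n : nat) Q (f : profile B n -> R) : R :=
  \sum_(v : profile B n) (\prod_i Q (v i)) * f v.

Definition upd (n : nat) (v : profile B n) (i : 'I_n) (b : B) : profile B n :=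
  [ffun j => if j == i then b else v j].

Lemma prod_ex_prod n M (f : 'I_n -> B -> R) :
  prod_ex M (fun v : profile B n => \prod_i f i (v i)) =
  \prod_i \sum_b M b * f i b.
Proof.
rewrite bigA_distr_bigA; apply: eq_bigr => v _.
by rewrite big_split.
Qed.

Lemma sum_prod_dist n M : \sum_b M b = 1 ->
  \sum_(v : profile B n) \prod_i M (v i) = 1.
Proof.
move=> M1; rewrite -(bigA_distr_bigA (fun (_ : 'I_n) b => M b)).
by rewrite big1.
Qed.

Lemma eq_prod_ex n M (f g : profile B n -> R) : f =1 g ->
  prod_ex M f = prod_ex M g.
Proof. by move=> fg; apply: eq_bigr => v _; rewrite fg. Qed.

Lemma prod_ex_cst n M (c : R) : \sum_b M b = 1 ->
  prod_ex M (fun _ : profile B n => c) = c.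
Proof. by move=> M1; rewrite /prod_ex -mulr_suml sum_prod_dist ?mul1r. Qed.

Lemma le_prod_ex n M (f g : profile B n -> R) : (forall b, 0 <= M b) ->
  (forall v, f v <= g v) -> prod_ex M f <= prod_ex M g.
Proof.
move=> M0 fg; apply: ler_sum => v _; apply: ler_wpM2l => //.
exact: prodr_ge0.
Qed.

Lemma prod_ex_gt0 n M (f : profile B n -> R) : is_dist M ->
  (forall v, 0 < f v) -> 0 < prod_ex M f.
Proof.
move=> [M0 M1] f0; have p0 (v : profile B n) : 0 <= (\prod_i M (v i)) * f v.
  by rewrite mulr_ge0 ?prodr_ge0// ltW.
rewrite lt_def sumr_ge0 ?andbT//.
apply/eqP => /psumr_eq0P E.
have /eqP : \sum_(v : profile B n) \prod_i M (v i) = 0.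
  apply: big1 => v _; have /eqP := E (fun w _ => p0 w) v isT.
  by rewrite mulf_eq0 (gt_eqF (f0 v)) orbF => /eqP.
by rewrite sum_prod_dist// oner_eq0.
Qed.

(** Swapping ballot [i] with a fresh independent one is an involution that preserves the law. A
    query to voter [i] thus becomes an average over the answer [b], the other ballots staying
    independent. *)
Lemma prod_ex_resample n M (i : 'I_n) (f : profile B n -> R) :
  \sum_b M b = 1 ->
  prod_ex M f = \sum_b M b * prod_ex M (fun v => f (upd v i b)).
Proof.
move=> M1.
pose swap (u : B * profile B n) := (u.2 i, upd u.2 i u.1).
have swapK : involutive swap.
  move=> [b v]; rewrite /swap /= ffunE eqxx; congr pair.
  by apply/ffunP => j; rewrite !ffunE; case: eqP => // ->.
transitivity (\sum_(u : B * profile B n)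
    (M u.1 * \prod_k M (u.2 k)) * f u.2).
  rewrite -[LHS]mul1r -[X in X * _ = _]M1 /prod_ex big_distrlr /= pair_bigA /=.
    by apply: eq_bigr => u _; rewrite mulrA.
rewrite (reindex_inj (inv_inj swapK)) /=.
transitivity (\sum_(u : B * profile B n)
    M u.1 * ((\prod_k M (u.2 k)) * f (upd u.2 i u.1))).
  apply: eq_bigr => -[b v] _ /=; rewrite mulrA; congr (_ * _).
  rewrite (bigD1 i)//= ffunE eqxx (bigD1 (P := predT) i)//=.
  rewrite mulrCA.
  congr (_ * (_ * _)).
  by apply: eq_bigr => k /negPf ki; rewrite ffunE ki.
rewrite -(pair_bigA _ (fun b (v : profile B n) => M b * ((\prod_k M (v k)) * f (upd v i b)))) /=.
by apply: eq_bigr => b _; rewrite /prod_ex mulr_sumr.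
Qed.

Lemma ln_le_subr1 (x : R) : 0 < x -> ln x <= x - 1.
Proof.
by move=> x0; have := @le_ln1Dx R (x - 1); rewrite addrCA subrr addr0; apply; lra.
Qed.

(* Donsker-Varadhan inequality, with the Kullback-Leibler divergence of
   [Q * rho] from [Q] replaced by the chi-square divergence. *)
Lemma change_of_measure Q rho (kappa : R) (W : B -> R) :
  is_dist Q -> (forall b, 0 <= rho b) -> \sum_b Q b * rho b = 1 ->
  \sum_b Q b * (rho b - 1) ^+ 2 <= kappa -> (forall b, 0 < W b) ->
  \sum_b Q b * rho b * ln (W b) <= kappa + ln (\sum_b Q b * W b).
Proof.
move=> [Q0 Q1] rho0 Qrho1 chi W0.
set Z := \sum_b Q b * W b.
have Z0 : 0 < Z.
  have QW0 b : 0 <= Q b * W b by rewrite mulr_ge0// ltW.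
  rewrite lt_def sumr_ge0 ?andbT//; apply/eqP => /psumr_eq0P E.
  have /eqP : \sum_b Q b = 0.
    apply: big1 => b _; have /eqP := E (fun b _ => QW0 b) b isT.
    by rewrite mulf_eq0 (gt_eqF (W0 b)) orbF => /eqP.
  by rewrite Q1 oner_eq0.
(* [ln x <= x - 1] is used at [W b / (rho b * Z)] and at [rho b]. After summation the first bound
   contributes 0 and the second the chi-square divergence. *)
have step b : Q b * rho b * ln (W b) <=
    Q b * W b / Z - Q b * rho b + Q b * rho b * (rho b - 1)
    + Q b * rho b * ln Z.
  have := rho0 b; rewrite le_eqVlt => /predU1P[<-|r0].
    rewrite !mulr0 !mul0r subr0 !addr0.
    by apply: divr_ge0; [apply: mulr_ge0 => //; exact: ltW | exact: ltW].
  have -> : ln (W b) = ln (W b / (rho b * Z)) + ln (rho b) + ln Z.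
    by rewrite ln_div ?posrE ?mulr_gt0// lnM ?posrE//; ring.
  have l1 := ln_le_subr1 (divr_gt0 (W0 b) (mulr_gt0 r0 Z0)).
  have l2 := ln_le_subr1 r0.
  have -> : Q b * W b / Z - Q b * rho b = Q b * rho b * (W b / (rho b * Z) - 1).
    by field; rewrite !gt_eqF.
  rewrite -!mulrDr; apply: ler_wpM2l; first by rewrite mulr_ge0.
  by rewrite lerD2r lerD.
apply: le_trans (ler_sum _ (fun b _ => step b)) _.
rewrite !big_split /= -!mulr_suml sumrN Qrho1 divff ?gt_eqF// subrr add0r mul1r.
rewrite lerD2r; apply: le_trans chi.
have -> : \sum_b Q b * (rho b - 1) ^+ 2 =
    \sum_b Q b * rho b * (rho b - 1) - (\sum_b Q b * rho b - \sum_b Q b).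
  rewrite -!sumrB; apply: eq_bigr => b _; ring.
by rewrite Qrho1 Q1 subrr subr0.
Qed.

(** * Information disclosed along a query tree *)

Section Trees.
Variables (n m : nat).
Implicit Types (t : query_tree B n m) (sigma : 'I_n -> option B).

(** [sigma] holds the answers received so far on a branch; voters not yet queried keep their random
    ballot from [v]. *)
Definition overlay (v : profile B n) sigma : profile B n :=
  [ffun i => odflt (v i) (sigma i)].

Definition known sigma : {set 'I_n} := [set i | sigma i].

(* The payoff is void after more than [s] new votes: the sample complexity does
   not bound the queries made on elections outside the promise, and those have
   positive probability. *)
Definition payoff t (f : 'I_m -> R) (s : nat) (D : {set 'I_n})
    (v : profile B n) : R :=
  if (#|queried t v :\: D| <= s)%N then f (run t v) else 0.

(** A chain rule, by induction on the tree with [sigma] and the budget [s] general. A query to a new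
    voter costs one [kappa], by [change_of_measure] applied to the expected exponential payoff [W]
    of the subtrees; a known voter costs nothing. *)
Lemma tree_change_of_measure Q rho (kappa : R) t (f : 'I_m -> R) sigma s :
  is_dist Q -> (forall b, 0 <= rho b) -> \sum_b Q b * rho b = 1 ->
  \sum_b Q b * (rho b - 1) ^+ 2 <= kappa ->
  prod_ex (fun b => Q b * rho b)
    (fun v => payoff t f s (known sigma) (overlay v sigma)) <=
  s%:R * kappa + ln (prod_ex Q
    (fun v => expR (payoff t f s (known sigma) (overlay v sigma)))).
Proof.
move=> dQ rho0 rho1 chi; have [Q0 Q1] := dQ.
have kappa0 : 0 <= kappa.
  apply: le_trans chi; apply: sumr_ge0 => b _; rewrite mulr_ge0// ?sqr_ge0//.
elim: t sigma s => [x|i next IH] sigma s.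
  rewrite /payoff /= finset.set0D cards0 leq0n !prod_ex_cst// expRK lerDr.
  by rewrite mulr_ge0.
(* A repeated query: the answer is forced by [sigma] and no budget is spent. *)
case Es : (sigma i) => [b|].
  have E v : payoff (Query i next) f s (known sigma) (overlay v sigma) =
             payoff (next b) f s (known sigma) (overlay v sigma).
    rewrite /payoff /= ffunE Es /= finset.setDUl.
    have -> : [set i] :\: known sigma = finset.set0.
      by apply/eqP; rewrite finset.setD_eq0 finset.sub1set inE Es.
    by rewrite finset.set0U.
  have := IH b sigma s; rewrite /prod_ex.
  by under eq_bigr do rewrite -E; under [X in ln X]eq_bigr do rewrite -E.
pose sig b j := if j == i then Some b else sigma j.
have Eq v b : (queried (Query i next) (overlay (upd v i b) sigma) :\: known sigma)
   = (i |: (queried (next b) (overlay v (sig b)) :\: known (sig b)))%SET.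
  have -> : overlay (upd v i b) sigma = overlay v (sig b).
    apply/ffunP => j; rewrite !ffunE /sig; case: eqP => // ->; by rewrite Es.
  apply/setP => j; rewrite /= ffunE /sig eqxx /= !inE.
  by case: eqP => [->|_] /=; rewrite ?Es.
have Eo v b : overlay (upd v i b) sigma = overlay v (sig b).
  apply/ffunP => j; rewrite !ffunE /sig; case: eqP => // ->; by rewrite Es.
have nin v b : i \notin (queried (next b) (overlay v (sig b)) :\: known (sig b)).
  by rewrite !inE /sig eqxx.
(* With no budget left for a new voter the payoff is identically 0, and both sides vanish. *)
case: s => [|s].
  have E v : payoff (Query i next) f 0 (known sigma) (overlay v sigma) = 0.
    rewrite /payoff; case: ifP => //; rewrite leqn0 cards_eq0 /= => /eqP/setP/(_ i).
    by rewrite !inE eqxx Es.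
  rewrite (eq_prod_ex _ E) (@eq_prod_ex _ Q _ (fun=> 1)); last first.
    by move=> v; rewrite E expR0.
  by rewrite !prod_ex_cst// ln1 mul0r addr0.
have E v b : payoff (Query i next) f s.+1 (known sigma) (overlay (upd v i b) sigma)
   = payoff (next b) f s (known (sig b)) (overlay v (sig b)).
  rewrite /payoff Eq cardsU1 nin add1n ltnS.
  by rewrite Eo /= ffunE /sig eqxx.
rewrite (prod_ex_resample i)// [X in ln X](prod_ex_resample i)//.
pose W b := prod_ex Q (fun v =>
  expR (payoff (next b) f s (known (sig b)) (overlay v (sig b)))).
have W0 b : 0 < W b by apply: prod_ex_gt0 => // v; exact: expR_gt0.
have -> : \sum_b Q b * prod_ex Q (fun v => expR (payoff (Query i next) f s.+1
    (known sigma) (overlay (upd v i b) sigma))) = \sum_b Q b * W b.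
  apply: eq_bigr => b _; congr (_ * _); apply: eq_bigr => v _; by rewrite E.
have := change_of_measure dQ rho0 rho1 chi W0.
move=> /(lerD (lexx (s%:R * kappa))) dv.
apply: le_trans (le_trans dv _); last by rewrite -natr1; lra.
(* The tilted law has mass 1, so [s * kappa] can be distributed over the answers [b], where the
   induction hypothesis applies. *)
rewrite -[s%:R * kappa]mul1r -{1}rho1 mulr_suml -big_split /=.
apply: ler_sum => b _; rewrite -mulrDr; apply: ler_wpM2l.
  exact: mulr_ge0.
apply: le_trans (IH b (sig b) s); apply: ler_sum => v _; by rewrite E.
Qed.

End Trees.
End Distributions.

(** * Fano's inequality for trees, then for randomized algorithms *)

Section LowerBound.
Variables (R : realType) (B : finType).
Implicit Types (Q M rho : B -> R).

(** For each [x] the payoff is [ln #|X|] on output [x] and 0 otherwise, so its exponential is at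
    most [1 + #|X|] or 1 respectively. Under [Q], which does not depend on [x], the outputs [x] have
    total probability at most 1. *)
Lemma tree_fano (n m : nat) (X : {set 'I_m}) Q (rho : 'I_m -> B -> R)
    (kappa : R) (s : nat) (t : query_tree B n m) :
  is_dist Q -> (0 < #|X|)%N ->
  (forall x, x \in X -> [/\ forall b, 0 <= rho x b, \sum_b Q b * rho x b = 1 &
     \sum_b Q b * (rho x b - 1) ^+ 2 <= kappa]) ->
  \sum_(x in X) prod_ex (fun b => Q b * rho x b)
     (fun v => ((#|queried t v| <= s)%N && (run t v == x))%:R) * ln #|X|%:R
  <= #|X|%:R * (s%:R * kappa + 1).
Proof.
move=> dQ X0 HX; have [Q0 Q1] := dQ.
set lam := ln #|X|%:R.
have lam0 : 0 <= lam by rewrite ln_ge0// ler1n.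
have step x : x \in X -> prod_ex (fun b => Q b * rho x b)
     (fun v => ((#|queried t v| <= s)%N && (run t v == x))%:R) * lam <=
   s%:R * kappa + #|X|%:R * prod_ex Q (fun v => (run t v == x)%:R).
  move=> xX; have [r0 r1 chi] := HX x xX.
  pose none (i : 'I_n) : option B := None.
  pose f (y : 'I_m) := lam * (y == x)%:R.
  have Eo (v : profile B n) : overlay v none = v by apply/ffunP => i; rewrite ffunE.
  have Ek : known none = finset.set0 by apply/setP => i; rewrite !inE.
  have := tree_change_of_measure t f none s dQ r0 r1 chi.
  rewrite Ek.
  rewrite (@eq_prod_ex _ _ _ _ _ (fun v =>
    ((#|queried t v| <= s)%N && (run t v == x))%:R * lam)); last first.
    move=> v; rewrite Eo /payoff finset.setD0 /f.
    by case: leqP => _ /=; rewrite ?mul0r// mulrC.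
  rewrite {1}/prod_ex; under eq_bigr do rewrite mulrA.
  rewrite -mulr_suml => /le_trans; apply; rewrite lerD2l.
  set E := prod_ex Q _.
  have E0 : 0 < E by apply: prod_ex_gt0 => // v; exact: expR_gt0.
  have -> : #|X|%:R = expR lam by rewrite lnK// posrE ltr0n.
  (* The [- 1] cancels the value 1 taken by the exponential when the payoff is 0. *)
  apply: le_trans (ln_le_subr1 E0) _; rewrite lerBlDl.
  have -> : 1 + expR lam * prod_ex Q (fun v => (run t v == x)%:R) =
      prod_ex Q (fun v => 1 + expR lam * (run t v == x)%:R).
    rewrite -{1}(@prod_ex_cst _ _ n Q 1 Q1) /prod_ex mulr_sumr -big_split /=.
    by apply: eq_bigr => v _; ring.
  apply: le_prod_ex => // v; rewrite Eo /payoff finset.setD0 /f.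
  have := expR_gt0 lam; case: leqP => _; case: (run t v == x) => /=;
    rewrite ?mulr1 ?mulr0 ?expR0; lra.
apply: le_trans (ler_sum _ step) _.
rewrite big_split /= sumr_const. rewrite -[X in X + _ <= _]mulr_natl mulrDr mulr1 lerD2l -mulr_sumr.
rewrite -[leRHS]mulr1 ler_wpM2l//.
rewrite exchange_big /=; under eq_bigr do rewrite -mulr_sumr.
rewrite -[leRHS](sum_prod_dist n Q1); apply: ler_sum => v _.
rewrite -[leRHS]mulr1 ler_wpM2l// ?prodr_ge0//.
have [rX|rX] := boolP (run t v \in X); last first.
  by rewrite big1 => // x xX; case: eqP => // rx; move: rX; rewrite rx xX.
rewrite (bigD1 (run t v))//= eqxx big1 ?addr0// => x /andP[_].
by rewrite eq_sym => /negPf ->.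
Qed.

(* The set of queried votes need not be measurable in the seed, so the seed is
   averaged out only after [tree_fano], whose conclusion involves outputs alone
   on the elections satisfying the promise. *)
Lemma sum_measure_le d (T : measurableType d) (mu : probability T R)
    (I : finType) (c : I -> R) (E : I -> set T) (C : R) :
  (forall i, 0 <= c i) -> (forall i, measurable (E i)) ->
  (forall w, \sum_i c i * \1_(E i) w <= C) ->
  (\sum_i (c i)%:E * mu (E i) <= C%:E)%E.
Proof.
move=> c0 mE cC.
have -> : (\sum_i (c i)%:E * mu (E i) =
   \int[mu]_w (\sum_i (c i * \1_(E i) w)%:E))%E.
  rewrite ge0_integral_sum//=; last 2 first.
  - by move=> i; apply/measurable_EFinP; apply: measurable_funM => //;
      exact: measurable_indic.
  - by move=> i w _; rewrite lee_fin mulr_ge0.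
  apply: eq_bigr => i _; under eq_integral do rewrite EFinM.
  rewrite ge0_integralZl//=; last 2 first.
  - by apply/measurable_EFinP; exact: measurable_indic.
  - by rewrite lee_fin.
  by rewrite integral_indic// setIT.
have C0 : 0 <= C by apply: le_trans (cC point); apply: sumr_ge0 => i _;
  rewrite mulr_ge0.
apply: (@le_trans _ _ (\int[mu]_w C%:E)%E).
  apply: ge0_le_integral => //=.
  - by move=> w _; apply: sume_ge0 => i _; rewrite lee_fin mulr_ge0.
  - apply: emeasurable_sum => i; apply/measurable_EFinP.
    by apply: measurable_funM => //; exact: measurable_indic.
  - by move=> w _; rewrite sumEFin lee_fin.
by rewrite integral_cst//= probability_setT mule1.
Qed.

Lemma queried_le_sample_complexity (n m : nat) (r : voting_rule B n m) (eps : R)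
    (A : algorithm R B n m) (v : profile B n) (w : seed A) :
  promise r eps v -> (#|queried (strategy w) v| <= sample_complexity r eps A)%N.
Proof.
move=> pv; rewrite /sample_complexity.
apply: leq_trans (leq_bigmax_cond _ pv).
have lt : (#|queried (strategy w) v| < n.+1)%N.
  by rewrite ltnS (leq_trans (max_card _))// card_ord.
apply: (@leq_bigmax_cond _ _ (fun s : 'I_n.+1 => s : nat) (Ordinal lt)).
by apply/asboolP; exists w.
Qed.

(** Averages [tree_fano] over the seed. The factor 1/2 is the probability that the drawn election
    satisfies the promise with winner [x]; there the algorithm succeeds with probability at least
    [1 - delta]. *)
Lemma algorithm_fano (n m : nat) (X : {set 'I_m}) Q (rho : 'I_m -> B -> R)
    (kappa eps delta : R) (r : voting_rule B n m) (A : algorithm R B n m) :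
  is_dist Q -> (0 < #|X|)%N -> delta <= 1 ->
  (forall x, x \in X -> [/\ forall b, 0 <= rho x b, \sum_b Q b * rho x b = 1 &
     \sum_b Q b * (rho x b - 1) ^+ 2 <= kappa]) ->
  (forall x, x \in X -> 1 / 2 <= prod_ex (fun b => Q b * rho x b)
     (fun v => (promise r eps v && (r v == x))%:R)) ->
  solves_winner_determination r eps delta A ->
  (1 - delta) / 2 * ln #|X|%:R <= (sample_complexity r eps A)%:R * kappa + 1.
Proof.
move=> dQ X0 d1 HX half sol; have [Q0 Q1] := dQ.
set s := sample_complexity r eps A.
set lam := ln #|X|%:R.
have lam0 : 0 <= lam by rewrite ln_ge0// ler1n.
pose c (u : 'I_m * profile B n) : R :=
  ((u.1 \in X) && (promise r eps u.2 && (r u.2 == u.1)))%:R *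
  ((\prod_i (Q (u.2 i) * rho u.1 (u.2 i))) * lam).
pose E (u : 'I_m * profile B n) : set (seed A) :=
  [set w | run (strategy w) u.2 = u.1]%classic.
have p0 x (v : profile B n) : x \in X -> 0 <= \prod_i (Q (v i) * rho x (v i)).
  by move=> /HX[r0 _ _]; apply: prodr_ge0 => i _; rewrite mulr_ge0.
have c0 u : 0 <= c u.
  rewrite /c; case: (boolP (u.1 \in X)) => [uX|_]; last by rewrite mul0r.
  by rewrite mulr_ge0// mulr_ge0// p0.
have mE u : measurable (E u) by exact: measurable_run.
(* For a fixed seed, the promise bounds the votes queried on [v] by [s], so every success weighted
   by [c] is also counted in [tree_fano]. *)
have cE w : \sum_u c u * \1_(E u) w <= #|X|%:R * (s%:R * kappa + 1).
  apply: le_trans (tree_fano s (strategy w) dQ X0 HX).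
  rewrite -(pair_bigA _ (fun x v => c (x, v) * \1_(E (x, v)) w)) /=.
  rewrite [leLHS](bigID (fun x => x \in X)) /= [X in _ + X]big1 ?addr0; last first.
    move=> x /negPf xX; rewrite big1// => v _.
    by rewrite /c /= xX /= !mul0r.
  apply: ler_sum => x xX; rewrite /prod_ex mulr_suml; apply: ler_sum => v _.
  rewrite /c /= xX /= indicE.
  have -> : (w \in E (x, v)) = (run (strategy w) v == x).
    by apply/idP/eqP; rewrite inE.
  rewrite mulrAC -/s mulrC [leRHS]mulrAC.
  apply: ler_wpM2l; first by rewrite mulr_ge0// p0.
  rewrite -natrM mulnb ler_nat.
  case: (boolP (promise r eps v)) => // pv.
  rewrite (queried_le_sample_complexity w pv) /=.
  by case: (r v == x); case: (_ == x).
have := sum_measure_le (seed_law A) c0 mE cE.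
have low u : ((c u * (1 - delta))%:E <= (c u)%:E * seed_law A (E u))%E.
  rewrite EFinM.
  case: (boolP (promise r eps u.2 && (r u.2 == u.1))) => [/andP[pv /eqP ru]|/negPf nu].
    apply: lee_wpmul2l; first by rewrite lee_fin.
    by have := sol _ pv; rewrite /E -ru.
  by rewrite /c nu andbF !mul0r !mul0e.
move=> /(le_trans (lee_sum _ (fun u _ => low u))).
rewrite sumEFin lee_fin -mulr_suml => le1.
rewrite -(@ler_pM2l _ #|X|%:R) ?ltr0n//; apply: le_trans le1.
have -> : #|X|%:R * ((1 - delta) / 2 * lam) = (#|X|%:R * (1 / 2) * lam) * (1 - delta).
  ring.
apply: ler_wpM2r; first by rewrite subr_ge0.
rewrite -(pair_bigA _ (fun x v => c (x, v))) /=.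
rewrite [leRHS](bigID (fun x => x \in X)) /= -[leLHS]addr0 lerD//; last first.
  by apply: sumr_ge0 => x _; apply: sumr_ge0.
rewrite mulr_natl -sumr_const mulr_suml; apply: ler_sum => x xX.
apply: le_trans (ler_wpM2r lam0 (half x xX)) _.
rewrite /prod_ex mulr_suml; apply: ler_sum => v _.
by rewrite /c /= xX /= mulrAC mulrC.
Qed.

(** * Concentration of score gaps and stability of the winner *)

(** Chernoff's method: with [t = mu / 4], the exponential moment of one ballot is at most [1 - t *
    mu + 2 * t ^+ 2 = 1 - mu ^+ 2 / 8], and its powers tend to 0. *)
Lemma prod_tail M (psi : B -> R) (eta : R) :
  is_dist M -> (forall b, `|psi b| <= 1) -> 0 < \sum_b M b * psi b -> 0 < eta ->
  exists n0 : nat, forall n, (n0 <= n)%N ->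
    prod_ex M (fun v : profile B n => (\sum_i psi (v i) < 0)%R%:R) <= eta.
Proof.
move=> [M0 M1] psi1 mu0 eta0; set mu := \sum_b M b * psi b in mu0.
have mu1 : mu <= 1.
  rewrite -M1; apply: ler_sum => b _; rewrite -[leRHS]mulr1 ler_wpM2l//.
  by have := psi1 b; rewrite ler_norml => /andP[].
pose t := mu / 4; pose c := 1 - mu ^+ 2 / 8.
have cn n : prod_ex M (fun v : profile B n => (\sum_i psi (v i) < 0)%R%:R) <= c ^+ n.
  apply: (@le_trans _ _ (prod_ex M (fun v : profile B n =>
      \prod_i expR (- (t * psi (v i)))))).
    apply: le_prod_ex => // v; rewrite -expR_sum sumrN -mulr_sumr.
    case: ltP => [neg|_]; last exact: expR_ge0.
    by rewrite -expR0 ler_expR oppr_ge0 nmulr_lle0// /t; lra.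
  rewrite (prod_ex_prod M (fun _ b => expR (- (t * psi b)))) prodr_const card_ord.
  apply: lerXn2r; rewrite ?nnegrE.
  - by apply: sumr_ge0 => b _; rewrite mulr_ge0// expR_ge0.
  - rewrite /c; nra.
  have -> : c = \sum_b M b * (1 - t * psi b + 2 * t ^+ 2).
    transitivity (\sum_b M b - t * mu + (\sum_b M b) * (2 * t ^+ 2)).
      by rewrite M1 /c /t; field.
    rewrite /mu mulr_sumr mulr_suml -sumrB -big_split /=.
    by apply: eq_bigr => b _; ring.
  apply: ler_sum => b _; apply: ler_wpM2l => //.
  (* For [u] between [- t] and [t], with [t <= 1 / 4], [exp (- u) <= 1 / (1 + u) <= 1 - u + 2 * t ^+
     2]. *)
  rewrite expRN.
  have := psi1 b; rewrite ler_norml => /andP[l1 l2].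
  have e1 : 1 + t * psi b <= expR (t * psi b) by exact: expR_ge1Dx.
  have t0 : 0 < t by rewrite /t; lra.
  have t4 : t <= 1 / 4 by rewrite /t; lra.
  have u1 : - t <= t * psi b by nra.
  have u2 : t * psi b <= t by nra.
  rewrite -[leLHS]mul1r ler_pdivrMr ?expR_gt0//.
  set u := t * psi b in e1 u1 u2 *.
  have : 1 <= (1 - u + 2 * t ^+ 2) * (1 + u) by nra.
  by move=> /le_trans; apply; apply: ler_wpM2l => //; nra.
have c1 : `|c| < 1 by rewrite ltr_norml /c; apply/andP; split; nra.
have /cvgrPdist_le /(_ eta eta0) [n0 _ Hn0] := cvg_expr c1.
exists n0 => n /Hn0 /=; rewrite sub0r normrN => le; apply: le_trans (cn n) _.
exact: le_trans (ler_norm _) le.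
Qed.

Lemma promise_of_stable (n m : nat) (r : voting_rule B n m) (eps : R)
    (v : profile B n) (x : 'I_m) : (0 < n)%N -> 0 < eps <= 1 ->
  (forall w : profile B n, #|[set i | w i != v i]|%:R < eps * n%:R -> r w = x) ->
  promise r eps v && (r v == x).
Proof.
move=> n0 /andP[e0 e1] H.
have rv : r v = x.
  apply: H; rewrite (_ : [set i | v i != v i] = finset.set0) ?cards0 ?mulr_gt0 ?ltr0n//.
  by apply/setP => i; rewrite !inE eqxx.
rewrite rv eqxx andbT /promise /margin_of_victory.
elim/big_ind: _ => [|a b Ha Hb|w].
(* The default [n.+1] of the margin exceeds [eps * n] because [eps <= 1]. *)
- by rewrite -natr1 (@le_trans _ _ n%:R)//; [rewrite ler_piMl|rewrite lerDl].
- by rewrite /minn; case: ifP.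
- move=> /eqP rw; rewrite leNgt; apply/negP => /H; by rewrite rv in rw *.
Qed.

Lemma eventually_forall (I : finType) (P : I -> nat -> Prop) :
  (forall i, exists n0 : nat, forall n, (n0 <= n)%N -> P i n) ->
  exists n0 : nat, forall n, (n0 <= n)%N -> forall i, P i n.
Proof.
move=> /choice[N HN]; exists (\max_i N i) => n le i; apply: HN.
exact: leq_trans (leq_bigmax i) le.
Qed.

(** The interface used by every rule. [h x y] is what one ballot contributes to the gap between [x]
    and [y], scaled so that changing a ballot moves the sum by at most 1. A mean above [eps] makes
    all sums at least [eps * n] with high probability, and fewer than [eps * n] changes keep them
    positive. *)
Lemma gap_lower_bound (m : nat) (X : {set 'I_m}) Q (phi : 'I_m -> B -> R)
    (h : 'I_m -> 'I_m -> B -> R) (a eps : R) :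
  is_dist Q -> (0 < #|X|)%N -> 0 <= a <= 1 -> 0 < eps <= 1 / 2 ->
  (forall x b, `|phi x b| <= 1) ->
  (forall x, x \in X -> \sum_b Q b * phi x b = 0) ->
  (forall x y b, `|h x y b| <= 1 / 2) ->
  (forall x y, x \in X -> eps < \sum_b Q b * (1 + a * phi x b) * h x y b) ->
  exists n0 : nat, forall n, (n0 <= n)%N -> forall r : voting_rule B n m,
    (forall x (w : profile B n), x \in X -> (forall y, 0 < \sum_i h x y (w i)) -> r w = x) ->
  forall delta (A : algorithm R B n m), delta <= 1 ->
    solves_winner_determination r eps delta A ->
    (1 - delta) / 2 * ln #|X|%:R <= (sample_complexity r eps A)%:R * a ^+ 2 + 1.
Proof.
move=> dQ X0 /andP[a0 a1] /andP[e0 e1] phi1 phi0 h1 gap; have [Q0 Q1] := dQ.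
pose rho x b := 1 + a * phi x b.
have rho0 x b : 0 <= rho x b.
  have := phi1 x b; rewrite /rho ler_norml => /andP[]; nra.
have rho1 x : x \in X -> \sum_b Q b * rho x b = 1.
  move=> xX; transitivity (\sum_b Q b + a * \sum_b Q b * phi x b).
    rewrite mulr_sumr -big_split /=; apply: eq_bigr => b _; rewrite /rho; ring.
  by rewrite Q1 phi0// mulr0 addr0.
have chi x : x \in X -> \sum_b Q b * (rho x b - 1) ^+ 2 <= a ^+ 2.
  move=> xX; rewrite -[leRHS]mul1r -[X in _ <= X * _]Q1 mulr_suml; apply: ler_sum => b _.
  apply: ler_wpM2l => //; have -> : rho x b - 1 = a * phi x b by rewrite /rho; ring.
  rewrite exprMn.
  rewrite -[leRHS]mulr1 ler_wpM2l ?sqr_ge0//.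
  by have := phi1 x b; rewrite ler_norml => /andP[]; nra.
have dP x : x \in X -> is_dist (fun b => Q b * rho x b).
  by move=> xX; split => [b|]; [rewrite mulr_ge0|exact: rho1].
(* Chosen so that the union bound over the [m] candidates [y] stays below 1/2. *)
pose eta : R := 1 / (2 * m.+1%:R).
have eta0 : 0 < eta by rewrite divr_gt0// mulr_gt0.
have tail (u : 'I_m * 'I_m) : exists n0 : nat, forall n, (n0 <= n)%N -> u.1 \in X ->
    prod_ex (fun b => Q b * rho u.1 b)
     (fun v : profile B n => (\sum_i (h u.1 u.2 (v i) - eps) < 0)%R%:R) <= eta.
  case: u => x y /=; have [xX|_] := boolP (x \in X); last by exists 0%N.
  have := @prod_tail _ (fun b => h x y b - eps) eta (dP x xX).
  case=> //.
  - move=> b; have := h1 x y b; rewrite !ler_norml => /andP[? ?]; apply/andP; split; lra.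
  - have := gap x y xX; rewrite -subr_gt0; congr (_ < _).
    rewrite -[X in _ - X]mul1r -[X in _ - X * _](rho1 x xX) mulr_suml -sumrB.
    by apply: eq_bigr => b _; rewrite /rho; ring.
  by move=> n0 Hn0; exists n0 => n /Hn0.
have [n0 Hn0] := eventually_forall tail.
exists n0.+1 => n n0n r Hr delta A d1 sol.
have {}Hn0 := Hn0 n (ltnW n0n).
apply: (algorithm_fano (rho := rho) dQ X0 d1 _ _ sol) => x xX.
  by split; [exact: rho0|exact: rho1|exact: chi].
have good (v : profile B n) : 1 - \sum_y (\sum_i (h x y (v i) - eps) < 0)%R%:R <=
    (promise r eps v && (r v == x))%:R :> R.
  have [y neg|pos] := pickP (fun y => \sum_i (h x y (v i) - eps) < 0).
    apply: (@le_trans _ _ 0); last by [].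
    rewrite subr_le0 (bigD1 y)//= neg lerDl; exact: sumr_ge0.
  have -> : promise r eps v && (r v == x).
    apply: promise_of_stable; [by case: n n0n {r Hr A sol Hn0 v pos}|lra|].
    move=> w wv; apply: Hr => // y.
    have {}pos : eps * n%:R <= \sum_i h x y (v i).
      have /negbT := pos y; rewrite -leNgt sumrB sumr_const card_ord subr_ge0.
      by rewrite mulr_natr.
    have : \sum_i (h x y (v i) - h x y (w i)) <= #|[set i | w i != v i]|%:R.
      rewrite -sum1_card natr_sum [leRHS]big_mkcond /=; apply: ler_sum => i _.
      rewrite inE; case: eqP => [->|_] /=; first by rewrite subrr.
      have := h1 x y (v i); have := h1 x y (w i).
      rewrite !ler_norml => /andP[? ?] /andP[? ?]; lra.
    rewrite sumrB; lra.
  by rewrite lerBlDr lerDl; exact: sumr_ge0.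
apply: le_trans (le_prod_ex (dP x xX).1 good).
have -> : prod_ex (fun b => Q b * rho x b) (fun v : profile B n =>
     1 - \sum_y (\sum_i (h x y (v i) - eps) < 0)%R%:R) =
   1 - \sum_y prod_ex (fun b => Q b * rho x b)
     (fun v : profile B n => (\sum_i (h x y (v i) - eps) < 0)%R%:R).
  rewrite -[X in _ = X - _](@prod_ex_cst _ _ n _ 1 (rho1 x xX)) /prod_ex [in RHS]exchange_big /=.
  rewrite -sumrB; apply: eq_bigr => v _; by rewrite mulrBr mulr_sumr.
have : \sum_y prod_ex (fun b => Q b * rho x b)
     (fun v : profile B n => (\sum_i (h x y (v i) - eps) < 0)%R%:R) <= 1 / 2.
  apply: (@le_trans _ _ (\sum_(y : 'I_m) eta)).
    by apply: ler_sum => y _; exact: (Hn0 (x, y)).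
  rewrite sumr_const card_ord -[X in X <= _]mulr_natr /eta mulrAC mul1r.
  rewrite ler_pdivrMr; last by rewrite mulr_gt0.
  by rewrite -[m.+1%:R]natr1; have := ler0n R m; lra.
lra.
Qed.

End LowerBound.

Lemma natr_card (R : realType) (I : finType) (A : {set I}) :
  #|A|%:R = \sum_i (i \in A)%:R :> R.
Proof.
rewrite -sum1_card natr_sum big_mkcond /=; apply: eq_bigr => i _.
by case: (i \in A).
Qed.

Lemma natr_card_set (R : realType) (I : finType) (P : pred I) :
  #|[set i | P i]|%:R = \sum_i (P i)%:R :> R.
Proof. by rewrite natr_card; apply: eq_bigr => i _; rewrite inE. Qed.

(** * Uniform rankings that keep the first p candidates on top *)

Section PrefixUniform.
Variables (R : realType) (m p : nat).
Hypothesis le_pm : (p <= m)%N.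
Implicit Types (s : 'S_m) (x y z : 'I_m).

Definition prefix_stab : {set 'S_m} :=
  [set s : 'S_m | [forall i : 'I_m, (i < p)%N ==> (s i < p)%N]].

Definition prefix_unif s : R := (s \in prefix_stab)%:R / #|prefix_stab|%:R.

(** A permutation mapping the finite prefix into itself maps it onto itself, hence also preserves
    the complement. *)
Lemma prefix_stab_lt s x : s \in prefix_stab -> (s x < p)%N = (x < p)%N.
Proof.
rewrite inE => /forallP sP; pose D := [set i : 'I_m | (i < p)%N].
have sD : s @: D = D.
  apply/eqP; rewrite eqEcard card_imset ?leqnn ?andbT; last exact: perm_inj.
  apply/fintype.subsetP => _ /imsetP[i iD ->]; rewrite inE in iD.
  by rewrite inE (implyP (sP i)).
have := mem_imset D x (@perm_inj _ s); by rewrite sD !inE.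
Qed.

Lemma card_prefix_stab_gt0 : (0 < #|prefix_stab|)%N.
Proof.
by apply/card_gt0P; exists 1%g; rewrite inE; apply/forallP => i; rewrite perm1 implybb.
Qed.

Lemma prefix_unif_dist : is_dist prefix_unif.
Proof.
split=> [s|]; first by rewrite divr_ge0.
by rewrite -mulr_suml -natr_card divff// pnatr_eq0 -lt0n card_prefix_stab_gt0.
Qed.

Lemma prefix_unif_sym x y (g : 'S_m -> R) : (x < p)%N -> (y < p)%N ->
  \sum_s prefix_unif s * g s =
  \sum_s prefix_unif s * g (tperm x y * s)%g.
Proof.
move=> xp yp; rewrite (reindex_inj (mulgI (tperm x y))) /=.
apply: eq_bigr => s _; congr (_%:R / _ * _); congr nat_of_bool.
have tpG (s' : 'S_m) : s' \in prefix_stab -> (tperm x y * s')%g \in prefix_stab.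
  move=> s'G; have := s'G; rewrite !inE => /forallP sP.
  apply/forallP => i; apply/implyP => ip; rewrite permM.
  by rewrite prefix_stab_lt//; case: tpermP.
apply/idP/idP => [/tpG|/tpG//].
by rewrite mulgA tperm2 mul1g.
Qed.

Lemma sum_prefix (f : nat -> R) s : s \in prefix_stab ->
  \sum_(x < m | (x < p)%N) f (s x) = \sum_(i < p) f i.
Proof.
move=> sG; rewrite (big_ord_widen m f le_pm) [RHS](reindex_inj (@perm_inj _ s)).
by apply: eq_bigl => x; rewrite prefix_stab_lt.
Qed.

(** By symmetry all prefix candidates have the same expectation, and on each ballot their positions
    run exactly through [0, ..., p - 1]. *)
Lemma prefix_unif_ex1 x (f : nat -> R) : (x < p)%N ->
  p%:R * \sum_s prefix_unif s * f (s x) = \sum_(i < p) f i.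
Proof.
move=> xp; transitivity
    (\sum_(y < m | (y < p)%N) \sum_s prefix_unif s * f (s y)).
  have E (y : 'I_m) : (y < p)%N -> \sum_s prefix_unif s * f (s y) =
      \sum_s prefix_unif s * f (s x).
    move=> yp; rewrite (prefix_unif_sym _ xp yp).
    by apply: eq_bigr => s _; rewrite permM tpermR.
  rewrite (eq_bigr _ E).
  rewrite -(big_ord_widen m (fun=> \sum_s prefix_unif s * f (s x)) le_pm).
  by rewrite sumr_const card_ord mulr_natl.
rewrite exchange_big /= -[RHS]mul1r -[X in _ = X * _](prefix_unif_dist.2) mulr_suml.
apply: eq_bigr => s _; rewrite -mulr_sumr /prefix_unif.
by case: (boolP (s \in prefix_stab)) => [/sum_prefix->//|_]; rewrite !mul0r.
Qed.

(** Two distinct prefix candidates occupy a uniform pair of distinct positions, whence the removed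
    diagonal [F i i]. Averaging over the second candidate reduces to [prefix_unif_ex1]. *)
Lemma prefix_unif_ex2 x y (F : nat -> nat -> R) : (x < p)%N -> (y < p)%N ->
  y != x ->
  p%:R * (p%:R - 1) * \sum_s prefix_unif s * F (s x) (s y) =
  \sum_(i < p) (\sum_(j < p) F i j - F i i).
Proof.
move=> xp yp yx; rewrite -mulrA.
rewrite -(prefix_unif_ex1 (fun i => \sum_(j < p) F i j - F i i) xp).
congr (_ * _); set E := \sum_s prefix_unif s * F (s x) (s y).
transitivity (\sum_(z < m | (z < p)%N && (z != x))
    \sum_s prefix_unif s * F (s x) (s z)).
  have Ez (z : 'I_m) : (z < p)%N && (z != x) ->
      \sum_s prefix_unif s * F (s x) (s z) = E.
    move=> /andP[zp zx]; rewrite (prefix_unif_sym _ yp zp).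
    by apply: eq_bigr => s _; rewrite !permM tpermR tpermD// eq_sym.
  rewrite (eq_bigr _ Ez).
  have : \sum_(z < m | (z < p)%N) E = E *+ p.
    by rewrite -(big_ord_widen m (fun=> E) le_pm) sumr_const card_ord.
  rewrite (bigD1 x)//= => /(canRL (addKr _)) ->.
  by rewrite mulrBl mul1r mulr_natl addrC.
rewrite exchange_big /=; apply: eq_bigr => s _; rewrite -mulr_sumr /prefix_unif.
case: (boolP (s \in prefix_stab)) => [sG|_]; last by rewrite !mul0r.
congr (_ * _); rewrite -(sum_prefix (F (s x)) sG) [X in _ = X - _](bigD1 x)//=.
by rewrite addrAC subrr add0r.
Qed.

End PrefixUniform.

(** * Sums over positions, logarithms and constants *)

Section Sums.
Variable R : realType.

Lemma sum_ord_nat (p : nat) : \sum_(i < p) i%:R = p%:R * (p%:R - 1) / 2 :> R.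
Proof.
elim: p => [|p IH]; first by rewrite big_ord0 mul0r mul0r.
by rewrite big_ord_recr /= IH -[p.+1%:R]natr1; field.
Qed.

Lemma sum_ord_lin (p : nat) (c : R) :
  \sum_(i < p) (c - 2 * i%:R) = p%:R * (c + 1 - p%:R).
Proof.
rewrite sumrB -mulr_sumr sum_ord_nat sumr_const card_ord -[c *+ p]mulr_natl.
by field.
Qed.

Lemma sum_ord_sq (p : nat) (c : R) : \sum_(i < p) (c - 2 * i%:R) ^+ 2 =
  p%:R * c ^+ 2 - 2 * c * p%:R * (p%:R - 1)
  + 2 / 3 * (p%:R - 1) * p%:R * (2 * p%:R - 1).
Proof.
elim: p => [|p IH]; first by rewrite big_ord0; field.
by rewrite big_ord_recr /= IH -[p.+1%:R]natr1; field.
Qed.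

Lemma sum_ord_lt (p k : nat) : (k <= p)%N -> \sum_(i < p) (i < k)%N%:R = k%:R :> R.
Proof.
move=> kp; transitivity (\sum_(i < p | (i < k)%N) (1 : R)).
  by rewrite [RHS]big_mkcond; apply: eq_bigr => i _; case: ifP.
by rewrite -(big_ord_widen p (fun=> 1) kp) sumr_const card_ord.
Qed.

Lemma card_ord_lt (m p : nat) : (p <= m)%N -> #|[set x : 'I_m | (x < p)%N]| = p.
Proof.
move=> pm; rewrite -sum1_card; under eq_bigl do rewrite inE.
by rewrite -(big_ord_widen m (fun=> 1%N) pm) sum1_card card_ord.
Qed.

Lemma ln_le_double (a b : nat) : (0 < a)%N -> (0 < b)%N -> (a <= b * b)%N ->
  ln a%:R <= 2 * ln b%:R :> R.
Proof.
move=> a0 b0 ab; have -> : 2 * ln b%:R = ln (b * b)%:R :> R.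
  by rewrite natrM lnM ?posrE ?ltr0n//; ring.
by rewrite ler_ln ?posrE ?ltr0n ?muln_gt0 ?b0// ler_nat.
Qed.

Lemma lt_of_ln (m : nat) (t : R) : 0 < t -> t <= ln m%:R -> t + 1 <= m%:R.
Proof.
move=> t0 tm; have m0 : 0 < m%:R :> R.
  rewrite ltNge; apply/negP => /ln0 l0; rewrite l0 in tm; lra.
by have := ln_le_subr1 m0; lra.
Qed.

(** The left side of Fano's bound is at least [(1 - delta) * lm / 4]; since [(1 - delta) * lm >= 8],
    half of it absorbs the additive 1. *)
Lemma lower_bound_of_fano (A eps delta s lm lX : R) : 0 < A -> 0 < eps ->
  0 <= delta < 1 -> lm <= 2 * lX -> 8 <= (1 - delta) * lm ->
  (1 - delta) / 2 * lX <= s * (A * eps) ^+ 2 + 1 ->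
  1 / (8 * A ^+ 2) * (lm / eps ^+ 2 * (1 - delta)) <= s.
Proof.
move=> A0 e0 d lmX K fano.
have -> : 1 / (8 * A ^+ 2) * (lm / eps ^+ 2 * (1 - delta)) =
    ((1 - delta) * lm / 8) / (A * eps) ^+ 2.
  by field; rewrite !gt_eqF.
rewrite ler_pdivrMr ?exprn_gt0 ?mulr_gt0//; nra.
Qed.

End Sums.

(** * The voting rules *)

Section Rules.
Variable R : realType.

(** Base law: a uniform set of approved candidates. The tilt favours sets containing [x] and creates
    a mean half-gap of [6 * eps] over every other candidate. *)
Lemma approval_lower_bound (m : nat) (eps : R) : (0 < m)%N -> 0 < eps <= 1 / 100 ->
  exists n0 : nat, forall n, (n0 <= n)%N ->
  forall r : voting_rule {set 'I_m} n m, approval_rule r ->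
  forall delta (A : algorithm R {set 'I_m} n m), delta <= 1 ->
    solves_winner_determination r eps delta A ->
    (1 - delta) / 2 * ln m%:R <= (sample_complexity r eps A)%:R * (24 * eps) ^+ 2 + 1.
Proof.
move=> m0 /andP[e0 e1].
pose N : R := #|{set 'I_m}|%:R.
have N0 : 0 < N by rewrite ltr0n; apply/card_gt0P; exists finset.set0.
pose Q (S : {set 'I_m}) : R := 1 / N.
pose e (x : 'I_m) (S : {set 'I_m}) : R := (x \in S)%:R - 1 / 2.
pose phi x S : R := 2 * e x S.
(* The value 1/2 at [y = x] makes the diagonal condition vacuous. *)
pose h (x y : 'I_m) S : R := if y == x then 1 / 2 else (e x S - e y S) / 2.
pose toggle (x : 'I_m) (S : {set 'I_m}) := [set y | (y \in S) (+) (y == x)].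
have toggleK x : involutive (toggle x).
  by move=> S; apply/setP => y; rewrite !inE addbK.
have e_toggle x S : e x (toggle x S) = - e x S.
  by rewrite /e inE eqxx addbT; case: (x \in S) => /=; lra.
have e_toggle_neq x y S : y != x -> e y (toggle x S) = e y S.
  by move=> /negPf yx; rewrite /e inE yx addbF.
have dQ : is_dist Q.
  split=> [S|]; first by rewrite divr_ge0// ltW.
  by rewrite sumr_const /Q -[LHS]mulr_natl -/N mul1r divff// gt_eqF.
(* Toggling the approval of [x] preserves the uniform law and reverses the sign of [e x]. *)
have odd0 x (g : {set 'I_m} -> R) : (forall S, g (toggle x S) = g S) ->
    \sum_S Q S * (e x S * g S) = 0.
  move=> gx; suff E : \sum_S Q S * (e x S * g S) = - \sum_S Q S * (e x S * g S).
    by move: E; lra.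
  rewrite [LHS](reindex_inj (inv_inj (toggleK x))) -sumrN /=.
  by apply: eq_bigr => S _; rewrite e_toggle gx /Q; ring.
have e1' x S : `|e x S| <= 1 / 2.
  by rewrite /e ler_norml; case: (x \in S) => /=; apply/andP; split; lra.
have [n0 Hn0] : exists n0 : nat, forall n, (n0 <= n)%N ->
  forall r : voting_rule {set 'I_m} n m,
  (forall x (w : profile {set 'I_m} n), x \in [set: 'I_m]%SET ->
     (forall y, 0 < \sum_i h x y (w i)) -> r w = x) ->
  forall delta (A : algorithm R {set 'I_m} n m), delta <= 1 ->
    solves_winner_determination r eps delta A ->
    (1 - delta) / 2 * ln #|[set: 'I_m]%SET|%:R <=
    (sample_complexity r eps A)%:R * (24 * eps) ^+ 2 + 1.
  apply: (gap_lower_bound (phi := phi) dQ).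
  - by rewrite cardsT card_ord.
  - apply/andP; split; lra.
  - apply/andP; split; lra.
  - move=> x S; have := e1' x S; rewrite /phi !ler_norml => /andP[? ?].
    apply/andP; split; lra.
  - move=> x _; have := odd0 x (fun=> 2) (fun=> erefl); apply: etrans.
    by apply: eq_bigr => S _; rewrite /phi; ring.
  - move=> x y S; rewrite /h; case: ifP => _; first by rewrite ger0_norm; lra.
    have := e1' x S; have := e1' y S; rewrite !ler_norml => /andP[? ?] /andP[? ?].
    apply/andP; split; lra.
  - move=> x y _; rewrite /h; case: eqVneq => [_|yx].
      have -> : \sum_S Q S * (1 + 24 * eps * phi x S) * (1 / 2) =
          (\sum_S Q S) * (1 / 2) + 24 * eps * \sum_S Q S * (e x S * 1).
        rewrite mulr_sumr mulr_suml -big_split /=; apply: eq_bigr => S _.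
        by rewrite /phi; field.
      by rewrite odd0// dQ.2; lra.
    have ee S : e x S * e x S = 1 / 4.
      by rewrite /e; case: (x \in S) => /=; field.
    have -> : \sum_S Q S * (1 + 24 * eps * phi x S) * ((e x S - e y S) / 2) =
        (1 / 2) * (\sum_S Q S * (e x S * 1)) - (1 / 2) * (\sum_S Q S * (e y S * 1))
        + (6 * eps) * (\sum_S Q S)
        - (24 * eps) * (\sum_S Q S * (e x S * e y S)).
      rewrite !mulr_sumr -sumrB -big_split -sumrB /=; apply: eq_bigr => S _.
      have -> : 6 * eps * Q S = 24 * eps * (e x S * e x S) * Q S by rewrite ee; field.
      by rewrite /phi; field.
    rewrite !odd0 ?dQ.2//; first lra.
    by move=> S; exact: e_toggle_neq.
exists n0 => n /Hn0 {}Hn0 r rmax delta A d1 sol.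
have := Hn0 r _ delta A d1 sol; rewrite cardsT card_ord; apply=> x w _ pos.
apply/eqP; apply/negPn/negP => nx.
have := pos (r w); rewrite /h (negPf nx).
rewrite -mulr_suml sumrB pmulr_lgt0 ?invr_gt0// subr_gt0 /e !sumrB ltrD2r.
by rewrite -!natr_card_set ltr_nat ltnNge rmax.
Qed.

(* Both the Borda score difference and the pairwise majority margin are of this
   form: for a fixed position [i] of the first candidate, the sum over the
   position of the second one is proportional to [m - 1 - 2 * i]. *)
Lemma positional_lower_bound (m : nat) (eps kap : R) (H : nat -> nat -> R) :
  (1 < m)%N -> 0 < eps <= 1 / 100 -> 1 / 4 <= kap ->
  (forall i j, (i < m)%N -> (j < m)%N -> `|H i j| <= 1 / 2) ->
  (forall i, H i i = 0) ->
  (forall i, (i < m)%N -> \sum_(j < m) H i j = kap * (m%:R - 1 - 2 * i%:R)) ->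
  exists n0 : nat, forall n, (n0 <= n)%N -> forall r : voting_rule 'S_m n m,
  (forall x (w : profile 'S_m n),
     (forall y, y != x -> 0 < \sum_i H (w i x) (w i y)) -> r w = x) ->
  forall delta (A : algorithm R 'S_m n m), delta <= 1 ->
    solves_winner_determination r eps delta A ->
    (1 - delta) / 2 * ln m%:R <= (sample_complexity r eps A)%:R * (24 * eps) ^+ 2 + 1.
Proof.
move=> m1 /andP[e0 e1] kap4 H1 H0 HS.
have mR : 2 <= m%:R :> R by rewrite ler_nat.
pose Q : 'S_m -> R := @prefix_unif R m m.
have dQ : is_dist Q by exact: prefix_unif_dist.
have Q1 := dQ.2.
pose f (i : nat) : R := (m%:R - 1 - 2 * i%:R) / (m%:R - 1).
pose phi (x : 'I_m) (s : 'S_m) : R := f (s x).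
pose h (x y : 'I_m) (s : 'S_m) : R := if y == x then 1 / 2 else H (s x) (s y).
have f0 x : \sum_(s : 'S_m) Q s * f (s x) = 0.
  have := prefix_unif_ex1 (leqnn m) f (ltn_ord x).
  rewrite -[\sum_(i < m) f i]mulr_suml sum_ord_lin.
  rewrite subrK subrr mulr0 mul0r => /eqP; rewrite mulf_eq0 => /orP[|/eqP//].
  by rewrite gt_eqF//; lra.
have [n0 Hn0] : exists n0 : nat, forall n, (n0 <= n)%N ->
  forall r : voting_rule 'S_m n m,
  (forall x (w : profile 'S_m n), x \in [set: 'I_m]%SET ->
     (forall y, 0 < \sum_i h x y (w i)) -> r w = x) ->
  forall delta (A : algorithm R 'S_m n m), delta <= 1 ->
    solves_winner_determination r eps delta A ->
    (1 - delta) / 2 * ln #|[set: 'I_m]%SET|%:R <=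
    (sample_complexity r eps A)%:R * (24 * eps) ^+ 2 + 1.
  apply: (gap_lower_bound (phi := phi) dQ).
  - by rewrite cardsT card_ord ltnW.
  - apply/andP; split; lra.
  - apply/andP; split; lra.
  - move=> x s; rewrite /phi /f ler_norml.
    have : (s x)%:R <= m%:R - 1 :> R.
      by rewrite lerBrDr natr1 ler_nat.
    have := ler0n R (s x) => ? ?.
    rewrite ler_pdivlMr ?ler_pdivrMr; [apply/andP; split|..]; lra.
  - by move=> x _; exact: f0.
  - move=> x y s; rewrite /h; case: ifP => _; first by rewrite ger0_norm; lra.
    exact: H1.
  - move=> x y _; rewrite /h; case: eqVneq => [_|yx].
      have -> : \sum_(s : 'S_m) Q s * (1 + 24 * eps * phi x s) * (1 / 2) =
          (\sum_(s : 'S_m) Q s) * (1 / 2) + 12 * eps * \sum_(s : 'S_m) Q s * f (s x).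
        rewrite mulr_sumr mulr_suml -big_split /=; apply: eq_bigr => s _.
        by rewrite /phi; field.
      by rewrite f0 Q1; lra.
    have := prefix_unif_ex2 (leqnn m)
      (fun i j => (1 + 24 * eps * f i) * H i j) (ltn_ord x) (ltn_ord y) yx.
    set E := \sum_(s : 'S_m) _.
    have -> : \sum_(s : 'S_m) Q s * (1 + 24 * eps * phi x s) * H (s x) (s y) = E.
      by apply: eq_bigr => s _; rewrite mulrA.
    have -> : \sum_(i < m) (\sum_(j < m) (1 + 24 * eps * f i) * H i j
          - (1 + 24 * eps * f i) * H i i) =
        kap * \sum_(i < m) (m%:R - 1 - 2 * i%:R)
        + 24 * eps * kap / (m%:R - 1) * \sum_(i < m) (m%:R - 1 - 2 * i%:R) ^+ 2.
      rewrite !mulr_sumr -big_split /=; apply: eq_bigr => i _.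
      rewrite -mulr_sumr H0 HS// /f; field; lra.
    rewrite sum_ord_lin sum_ord_sq => EE.
    (* As [kap >= 1 / 4], the mean gap is at least [2 * eps * (m + 1) / (m - 1)], above [eps]. *)
    have {}EE : (m%:R - 1) * E = 8 * eps * kap * (m%:R + 1).
      apply: (@mulfI _ m%:R); first by rewrite gt_eqF; lra.
      rewrite mulrA EE; field; lra.
    rewrite -(@ltr_pM2l _ (m%:R - 1)); last lra.
    have em : 0 < eps * (m%:R + 1) by rewrite mulr_gt0//; lra.
    have : 0 <= (kap - 1 / 4) * (eps * (m%:R + 1)) by rewrite mulr_ge0; lra.
    rewrite EE; lra.
exists n0 => n /Hn0 {}Hn0 r Hr delta A d1 sol.
have := Hn0 r _ delta A d1 sol; rewrite cardsT card_ord; apply=> x w _ pos.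
apply: Hr => y /negPf yx; have := pos y; by rewrite /h yx.
Qed.

Lemma borda_lower_bound (m : nat) (eps : R) : (1 < m)%N -> 0 < eps <= 1 / 100 ->
  exists n0 : nat, forall n, (n0 <= n)%N ->
  forall r : voting_rule 'S_m n m, borda_rule r ->
  forall delta (A : algorithm R 'S_m n m), delta <= 1 ->
    solves_winner_determination r eps delta A ->
    (1 - delta) / 2 * ln m%:R <= (sample_complexity r eps A)%:R * (24 * eps) ^+ 2 + 1.
Proof.
move=> m1 eps1; have mR : 2 <= m%:R :> R by rewrite ler_nat.
pose H (i j : nat) : R := (j%:R - i%:R) / (2 * m%:R).
have [i j im jm|i|i im|n0 Hn0] :=
  @positional_lower_bound m eps (1 / 4) H m1 eps1 (lexx _).
- have : i%:R <= m%:R :> R by rewrite ler_nat ltnW.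
  have : j%:R <= m%:R :> R by rewrite ler_nat ltnW.
  have := ler0n R i; have := ler0n R j => ? ? ? ?.
  rewrite ler_norml ler_pdivlMr ?ler_pdivrMr; [apply/andP; split|..]; lra.
- by rewrite /H subrr mul0r.
- rewrite -mulr_suml sumrB sum_ord_nat sumr_const card_ord -[i%:R *+ m]mulr_natl.
  by field; lra.
exists n0 => n /Hn0 {}Hn0 r rmax delta A; apply: Hn0 => x w pos.
apply/eqP; apply/negPn/negP => nx; have := pos _ nx.
rewrite -mulr_suml pmulr_lgt0 ?invr_gt0; last lra.
have bs z : (borda_score w z)%:R = \sum_i (m%:R - 1 - (w i z)%:R) :> R.
  rewrite /borda_score natr_sum; apply: eq_bigr => i _.
  by rewrite natrB// -natr1; ring.
have -> : \sum_i ((w i (r w))%:R - (w i x)%:R) =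
    (borda_score w x)%:R - (borda_score w (r w))%:R :> R.
  by rewrite !bs -sumrB; apply: eq_bigr => i _; ring.
by rewrite subr_gt0 ltr_nat ltnNge rmax.
Qed.

(** Here [H] is half the sign of [j - i], so positive gaps say that [x] is a Condorcet winner, and
    consistency alone determines the outcome. *)
Lemma condorcet_lower_bound (m : nat) (eps : R) : (1 < m)%N -> 0 < eps <= 1 / 100 ->
  exists n0 : nat, forall n, (n0 <= n)%N ->
  forall r : voting_rule 'S_m n m, condorcet_consistent r ->
  forall delta (A : algorithm R 'S_m n m), delta <= 1 ->
    solves_winner_determination r eps delta A ->
    (1 - delta) / 2 * ln m%:R <= (sample_complexity r eps A)%:R * (24 * eps) ^+ 2 + 1.
Proof.
move=> m1 eps1.
pose H (i j : nat) : R := ((i < j)%N%:R - (j < i)%N%:R) / 2.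
have k4 : 1 / 4 <= 1 / 2 :> R by lra.
have [i j _ _|i|i im|n0 Hn0] := @positional_lower_bound m eps (1 / 2) H m1 eps1 k4.
- rewrite /H ler_norml; case: (ltngtP i j) => _ /=; apply/andP; split; lra.
- by rewrite /H subrr mul0r.
- rewrite -mulr_suml sumrB (sum_ord_lt R (ltnW im)).
  have -> : \sum_(j < m) (i < j)%N%:R = \sum_(j < m) (1 - (j < i.+1)%N%:R) :> R.
    by apply: eq_bigr => j _; rewrite ltnS; case: leqP => _ /=; lra.
  rewrite sumrB sumr_const card_ord (sum_ord_lt R im) -[i.+1%:R]natr1 /=; by field.
exists n0 => n /Hn0 {}Hn0 r rcond delta A; apply: Hn0 => x w pos.
apply: rcond => y /pos; rewrite -mulr_suml pmulr_lgt0 ?invr_gt0//.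
by rewrite sumrB -!natr_card_set subr_gt0 ltr_nat /pairwise_margin subr_gt0 ltz_nat.
Qed.

(* Only the first [p] candidates compete: with [p = min m (2 * k)] the probability
   [theta] for such a candidate to be approved stays away from 0 and 1. *)
Lemma k_approval_lower_bound (k m p : nat) (a eps theta eta : R) :
  (0 < k < p)%N -> (p <= m)%N -> (p <= 2 * k)%N ->
  0 < eps < 1 / 4 -> 0 <= a <= 1 -> theta = k%:R / p%:R ->
  eta <= theta * (1 - theta) -> 2 * eps < a * eta ->
  exists n0 : nat, forall n, (n0 <= n)%N ->
  forall r : voting_rule 'S_m n m, k_approval_rule k r ->
  forall delta (A : algorithm R 'S_m n m), delta <= 1 ->
    solves_winner_determination r eps delta A ->
    (1 - delta) / 2 * ln p%:R <= (sample_complexity r eps A)%:R * a ^+ 2 + 1.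
Proof.
move=> /andP[k0 kp] pm p2k /andP[e0 e1] /andP[a0 a1] thE etaP ae.
have kR : 1 <= k%:R :> R by rewrite ler1n.
have kpR : k%:R + 1 <= p%:R :> R by rewrite natr1 ler_nat.
have p2kR : p%:R <= 2 * k%:R :> R by rewrite -natrM ler_nat.
have pth : p%:R * theta = k%:R by rewrite thE; field; lra.
have th2 : 1 / 2 <= theta by rewrite thE ler_pdivlMr; lra.
have th1 : theta <= 1 by rewrite thE ler_pdivrMr; lra.
pose Q : 'S_m -> R := @prefix_unif R m p.
have dQ : is_dist Q by exact: prefix_unif_dist.
have Q1 := dQ.2.
pose f (i : nat) : R := (i < k)%N%:R - theta.
pose phi (x : 'I_m) (s : 'S_m) : R := f (s x).
pose h (x y : 'I_m) (s : 'S_m) : R :=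
  if y == x then 1 / 2 else ((s x < k)%N%:R - (s y < k)%N%:R) / 2.
have sumk := sum_ord_lt R (ltnW kp).
have sumf : \sum_(i < p) f i = 0.
  by rewrite sumrB sumk sumr_const card_ord -[theta *+ p]mulr_natl pth subrr.
have sumf2 : \sum_(i < p) f i ^+ 2 = p%:R * (theta * (1 - theta)).
  transitivity (\sum_(i < p) ((1 - 2 * theta) * (i < k)%N%:R + theta ^+ 2)).
    by apply: eq_bigr => i _; rewrite /f; case: (i < k)%N => /=; ring.
  rewrite big_split /= -mulr_sumr sumk sumr_const card_ord -[_ *+ p]mulr_natl -pth.
  by ring.
have f0 (x : 'I_m) : (x < p)%N -> \sum_(s : 'S_m) Q s * f (s x) = 0.
  move=> xp; have := prefix_unif_ex1 pm f xp; rewrite sumf => /eqP.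
  by rewrite mulf_eq0 => /orP[|/eqP//]; rewrite gt_eqF//; lra.
have cX : #|[set x : 'I_m | (x < p)%N]| = p by exact: card_ord_lt.
have f1 i : `|f i| <= 1.
  rewrite /f ler_norml; case: (i < k)%N => /=; apply/andP; split; lra.
have [n0 Hn0] : exists n0 : nat, forall n, (n0 <= n)%N ->
  forall r : voting_rule 'S_m n m,
  (forall x (w : profile 'S_m n), x \in [set x : 'I_m | (x < p)%N] ->
     (forall y, 0 < \sum_i h x y (w i)) -> r w = x) ->
  forall delta (A : algorithm R 'S_m n m), delta <= 1 ->
    solves_winner_determination r eps delta A ->
    (1 - delta) / 2 * ln #|[set x : 'I_m | (x < p)%N]|%:R <=
    (sample_complexity r eps A)%:R * a ^+ 2 + 1.
  apply: (gap_lower_bound (phi := phi) dQ).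
  - by rewrite cX (leq_trans _ kp).
  - by rewrite a0.
  - by apply/andP; split; lra.
  - by move=> x s; exact: f1.
  - by move=> x; rewrite inE; exact: f0.
  - move=> x y s; rewrite /h; case: ifP => _; first by rewrite ger0_norm; lra.
    rewrite ler_norml; case: (s x < k)%N; case: (s y < k)%N => /=;
      apply/andP; split; lra.
  - move=> x y; rewrite inE => xp; rewrite /h; case: eqVneq => [_|yx].
      have -> : \sum_(s : 'S_m) Q s * (1 + a * phi x s) * (1 / 2) =
          (\sum_s Q s) * (1 / 2) + a / 2 * \sum_(s : 'S_m) Q s * f (s x).
        rewrite mulr_sumr mulr_suml -big_split /=; apply: eq_bigr => s _.
        by rewrite /phi; field.
      by rewrite f0// Q1; lra.
    have etap : eta * a <= theta * (1 - theta) * a by rewrite ler_wpM2r.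
    set E := \sum_(s : 'S_m) _.
    (* A dummy candidate [y >= p] sits at position at least [p > k] and is never approved. *)
    have [yp|yp] := ltnP y p; last first.
      have EE : \sum_(s : 'S_m) Q s * ((1 + a * f (s x)) * (s x < k)%N%:R / 2) = E.
        apply: eq_bigr => s _; rewrite /Q /prefix_unif.
        case: (boolP (s \in _)) => [sG|_]; last by rewrite !mul0r.
        have -> : (s y < k)%N = false.
          apply/negbTE; rewrite -leqNgt (leq_trans (ltnW kp))//.
          by rewrite leqNgt prefix_stab_lt// -leqNgt.
        by rewrite /phi subr0; field; rewrite pnatr_eq0 -lt0n card_prefix_stab_gt0.
      have := prefix_unif_ex1 pm (fun i => (1 + a * f i) * (i < k)%N%:R / 2) xp.
      rewrite EE.
      have -> : \sum_(i < p) ((1 + a * f i) * (i < k)%N%:R / 2) =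
          (1 + a * (1 - theta)) / 2 * \sum_(i < p) (i < k)%N%:R.
        rewrite mulr_sumr; apply: eq_bigr => i _.
        by rewrite /f; case: (i < k)%N => /=; field.
      rewrite sumk -pth mulrCA => /mulfI ->; last by rewrite gt_eqF//; lra.
      have : 0 <= theta * (1 - theta) * a by rewrite !mulr_ge0//; lra.
      lra.
    have := prefix_unif_ex2 pm
      (fun i j => (1 + a * f i) * (((i < k)%N%:R - (j < k)%N%:R) / 2)) xp yp yx.
    have -> : \sum_(s : 'S_m) prefix_unif R p s * ((1 + a * f (s x)) *
        (((s x < k)%N%:R - (s y < k)%N%:R) / 2)) = E.
      by apply: eq_bigr => s _; rewrite mulrA.
    have -> : \sum_(i < p) (\sum_(j < p)
          (1 + a * f i) * (((i < k)%N%:R - (j < k)%N%:R) / 2)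
          - (1 + a * f i) * (((i < k)%N%:R - (i < k)%N%:R) / 2)) =
        p%:R / 2 * (\sum_(i < p) f i) + a * p%:R / 2 * \sum_(i < p) f i ^+ 2.
      rewrite !mulr_sumr -big_split /=; apply: eq_bigr => i _.
      rewrite -mulr_sumr -mulr_suml sumrB sumk sumr_const card_ord.
      by rewrite -[_ *+ p]mulr_natl -pth /f; field.
    rewrite sumf sumf2 => EE.
    have {}EE : (p%:R - 1) * E = a * p%:R / 2 * (theta * (1 - theta)).
      apply: (@mulfI _ p%:R); first by rewrite gt_eqF; lra.
      by rewrite [LHS]mulrA EE; field.
    rewrite -(@ltr_pM2l _ (p%:R - 1)); last lra.
    have : (2 * eps) * p%:R < (theta * (1 - theta) * a) * p%:R.
      by rewrite ltr_pM2r; lra.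
    rewrite EE; lra.
exists n0 => n /Hn0 {}Hn0 r rmax delta A d1 sol.
have := Hn0 r _ delta A d1 sol; rewrite cX; apply=> x w _ pos.
apply/eqP; apply/negPn/negP => nx.
have := pos (r w); rewrite /h (negPf nx).
rewrite -mulr_suml sumrB pmulr_lgt0 ?invr_gt0// subr_gt0.
by rewrite -!natr_card_set ltr_nat ltnNge rmax.
Qed.

(** Every rival lacks a majority at level [l], hence at all lower levels since [top_count] grows
    with the level, so its score exceeds [l]. The default [m] of the minimum also exceeds [l]. *)
Lemma bucklin_winner (n m l : nat) (r : voting_rule 'S_m n m) (w : profile 'S_m n)
    (x : 'I_m) : bucklin_rule r -> (l < m)%N -> (n < 2 * top_count w l x)%N ->
  (forall y, y != x -> (2 * top_count w l y < n)%N) -> r w = x.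
Proof.
move=> rmin lm xl yl; apply/eqP; apply/negPn/negP => nx.
have xs : (bucklin_score w x <= l)%N.
  have lm1 : (l < m.+1)%N by rewrite ltnW.
  exact: (@bigmin_le_cond _ nat 'I_m.+1 m (Ordinal lm1)
    (fun i => (n < 2 * top_count w i x)%N) (fun i => i : nat) xl).
suff : (l < bucklin_score w (r w))%N.
  by rewrite ltnNge (leq_trans (rmin w x) xs).
rewrite /bucklin_score; elim/big_ind: _ => [//|a b la lb|i ni].
  by rewrite leq_min la.
rewrite ltnNge; apply/negP => il.
have := ltn_trans (yl _ nx) ni; rewrite ltn_mul2l /= ltnNge => /negP; apply.
apply: subset_leq_card; apply/fintype.subsetP => j; rewrite !inE => ji.
exact: leq_trans ji il.
Qed.

(* The candidates [x < 2 * l] are equally likely to be above or below position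
   [l]; the reversed identity ballot, of weight [3 * eps], ranks only dummy
   candidates above position [l] and so pushes all the others below one half
   by an amount of order [eps]. *)
Lemma bucklin_lower_bound (l m : nat) (eps : R) :
  (0 < l)%N -> (3 * l <= m)%N -> 0 < eps <= 1 / 100 ->
  exists n0 : nat, forall n, (n0 <= n)%N ->
  forall r : voting_rule 'S_m n m, bucklin_rule r ->
  forall delta (A : algorithm R 'S_m n m), delta <= 1 ->
    solves_winner_determination r eps delta A ->
    (1 - delta) / 2 * ln (2 * l)%N%:R <=
    (sample_complexity r eps A)%:R * (24 * eps) ^+ 2 + 1.
Proof.
move=> l0 lm /andP[e0 e1]; pose p := (2 * l)%N.
have pm : (p <= m)%N by rewrite /p; lia.
have lp : (l <= p)%N by rewrite /p; lia.
have lR : 1 <= l%:R :> R by rewrite ler1n.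
have pR : p%:R = 2 * l%:R :> R by rewrite natrM.
pose G := @prefix_stab m p.
pose U : 'S_m -> R := @prefix_unif R m p.
have dU : is_dist U by exact: prefix_unif_dist.
have [U0 U1] := dU.
pose rho : 'S_m := perm (@rev_ord_inj m).
have rhoE (x : 'I_m) : (rho x : nat) = (m - x.+1)%N by rewrite permE.
have rhoG : (rho \in G) = false.
  apply/negbTE; rewrite inE negb_forall.
  have m0 : (0 < m)%N by lia.
  apply/existsP; exists (Ordinal m0); rewrite negb_imply rhoE /=.
  by rewrite /p; apply/andP; split; lia.
pose Q (s : 'S_m) : R := (1 - 3 * eps) * U s + 3 * eps * (s == rho)%:R.
have QE (g : 'S_m -> R) : \sum_s Q s * g s =
    (1 - 3 * eps) * (\sum_s U s * g s) + 3 * eps * g rho.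
  have -> : g rho = \sum_(s : 'S_m) (s == rho)%:R * g s.
    rewrite (bigD1 rho)//= eqxx mul1r big1 ?addr0// => s /negPf ->.
    by rewrite mul0r.
  rewrite !mulr_sumr -big_split /=; apply: eq_bigr => s _; rewrite /Q; ring.
have dQ : is_dist Q.
  split=> [s|]; first by rewrite /Q addr_ge0// !mulr_ge0//; lra.
  have := QE (fun=> 1); rewrite mulr1 -mulr_suml mulr1 => ->.
  by rewrite -mulr_suml U1; ring.
pose f (i : nat) : R := (i < l)%N%:R - 1 / 2.
(* The indicator of [G] leaves the weight of [rho] untouched by the tilt, which keeps the mean of
   [phi] at 0. *)
pose phi (x : 'I_m) (s : 'S_m) : R := (s \in G)%:R * f (s x).
(* The diagonal carries a condition here: [x] must exceed one half at level [l], and every other [y]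
   must fall below it. *)
pose h (x y : 'I_m) (s : 'S_m) : R := if y == x then f (s x) else - f (s y).
have sumk := sum_ord_lt R lp.
have sumf : \sum_(i < p) f i = 0.
  by rewrite sumrB sumk sumr_const card_ord -[_ *+ p]mulr_natl pR; field.
have ff i : f i * f i = 1 / 4.
  by rewrite /f; case: (i < l)%N => /=; field.
have f1 i : `|f i| <= 1 / 2.
  rewrite /f ler_norml; case: (i < l)%N => /=; apply/andP; split; lra.
have f0 (x : 'I_m) : (x < p)%N -> \sum_(s : 'S_m) U s * f (s x) = 0.
  move=> xp; have := prefix_unif_ex1 pm f xp; rewrite sumf => /eqP.
  by rewrite mulf_eq0 => /orP[|/eqP//]; rewrite gt_eqF// pR; lra.
have UG s (z : R) : U s * ((s \in G)%:R * z) = U s * z.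
  rewrite /U /prefix_unif -/G; case: (s \in G); first by rewrite !mul1r.
  by rewrite !mul0r.
have phirho x : phi x rho = 0 by rewrite /phi rhoG mul0r.
(* For [x < 2 * l], [rho] gives position [m - 1 - x >= l], because [3 * l <= m]. *)
have frho (x : 'I_m) : (x < p)%N -> f (rho x) = - (1 / 2).
  move=> xp; rewrite /f rhoE; case: ltnP => /=; last by move=> _; lra.
  by move: xp; rewrite /p; lia.
have cX : #|[set x : 'I_m | (x < p)%N]| = p by exact: card_ord_lt.
have [n0 Hn0] : exists n0 : nat, forall n, (n0 <= n)%N ->
  forall r : voting_rule 'S_m n m,
  (forall x (w : profile 'S_m n), x \in [set x : 'I_m | (x < p)%N] ->
     (forall y, 0 < \sum_i h x y (w i)) -> r w = x) ->
  forall delta (A : algorithm R 'S_m n m), delta <= 1 ->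
    solves_winner_determination r eps delta A ->
    (1 - delta) / 2 * ln #|[set x : 'I_m | (x < p)%N]|%:R <=
    (sample_complexity r eps A)%:R * (24 * eps) ^+ 2 + 1.
  apply: (gap_lower_bound (phi := phi) dQ).
  - by rewrite cX muln_gt0 l0.
  - by apply/andP; split; lra.
  - by apply/andP; split; lra.
  - move=> x s; rewrite /phi; case: (s \in G); rewrite ?mul1r ?mul0r ?normr0//.
    by apply: le_trans (f1 _) _; lra.
  - move=> x; rewrite inE => xp; rewrite QE phirho mulr0 addr0.
    rewrite (eq_bigr (fun s : 'S_m => U s * f (s x))) ?f0 ?mulr0// => s _.
    exact: UG.
  - by move=> x y s; rewrite /h; case: ifP => _; rewrite ?normrN; exact: f1.
  - move=> x y; rewrite inE => xp.
    have -> : \sum_(s : 'S_m) Q s * (1 + 24 * eps * phi x s) * h x y s =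
      (1 - 3 * eps) * (\sum_(s : 'S_m) U s * ((1 + 24 * eps * f (s x)) * h x y s))
      + 3 * eps * h x y rho.
      under eq_bigr do rewrite -mulrA.
      rewrite QE phirho mulr0 addr0 mul1r; congr (_ * _ + _).
      apply: eq_bigr => s _.
      transitivity (U s * h x y s + 24 * eps * h x y s *
        (U s * ((s \in G)%:R * f (s x)))); first by rewrite /phi; ring.
      by rewrite UG; ring.
    rewrite /h; case: eqVneq => [_|yx].
      rewrite frho//.
      have -> : \sum_(s : 'S_m) U s * ((1 + 24 * eps * f (s x)) * f (s x)) =
          \sum_(s : 'S_m) U s * f (s x) + 6 * eps * \sum_s U s.
        rewrite mulr_sumr -big_split /=; apply: eq_bigr => s _.
        transitivity (U s * f (s x) + 24 * eps * (f (s x) * f (s x)) * U s).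
          by ring.
        by rewrite ff; field.
      by rewrite f0// U1; nra.
    have [yp|yp] := ltnP y p; last first.
      have -> : \sum_(s : 'S_m) U s * ((1 + 24 * eps * f (s x)) * - f (s y)) =
          1 / 2 * (\sum_s U s) + 12 * eps * \sum_(s : 'S_m) U s * f (s x).
        rewrite !mulr_sumr -big_split /=; apply: eq_bigr => s _.
        rewrite /U /prefix_unif; case: (boolP (s \in _)) => [sG|_]; last first.
          by rewrite !mul0r !mulr0 addr0.
        have -> : f (s y) = - (1 / 2).
          rewrite /f ltnNge (leq_trans lp) /=; first lra.
          by rewrite leqNgt prefix_stab_lt// -leqNgt.
        by field; rewrite pnatr_eq0 -lt0n card_prefix_stab_gt0.
      rewrite f0// U1; have := f1 (rho y); rewrite ler_norml => /andP[_ f2].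
      have : 3 * eps * (- (1 / 2)) <= 3 * eps * - f (rho y) by nra.
      lra.
    rewrite frho//.
    have := prefix_unif_ex2 pm
      (fun i j => (1 + 24 * eps * f i) * - f j) xp yp yx.
    set E := \sum_(s : 'S_m) _; rewrite -/E.
    have -> : \sum_(i < p) (\sum_(j < p) (1 + 24 * eps * f i) * - f j -
          (1 + 24 * eps * f i) * - f i) = \sum_(i < p) (f i + 6 * eps).
      apply: eq_bigr => i _; rewrite -mulr_sumr sumrN sumf.
      transitivity (f i + 24 * eps * (f i * f i)); first by ring.
      by rewrite ff; field.
    rewrite big_split /= sumf sumr_const card_ord -[6 * eps *+ p]mulr_natl add0r.
    (* The tilt alone yields only [6 * eps / (p - 1)], too small for large [p]; the ballot [rho]
       adds the needed [3 * eps / 2]. *)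
    rewrite -mulrA => /mulfI EE; have {}EE : (p%:R - 1) * E = 6 * eps.
      by apply: EE; rewrite gt_eqF//; lra.
    have E0 : 0 <= E.
      by rewrite -(@pmulr_rge0 _ (p%:R - 1)) ?EE; lra.
    have : 0 <= (1 - 3 * eps) * E by rewrite mulr_ge0//; lra.
    by rewrite /E /U; lra.
exists n0 => n /Hn0 {}Hn0 r rmin delta A d1 sol.
have := Hn0 r _ delta A d1 sol; rewrite cX; apply=> x w _ pos.
have topE z : \sum_i f (w i z) = (top_count w l z)%:R - n%:R / 2 :> R.
  rewrite sumrB -natr_card_set sumr_const card_ord -[_ *+ n]mulr_natl.
  by rewrite /top_count; field.
apply: (bucklin_winner rmin (l := l)); first lia.
  have := pos x; rewrite /h eqxx topE -(ltr_nat R) natrM; lra.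
move=> y /negPf yx; have := pos y; rewrite /h yx sumrN topE.
rewrite -(ltr_nat R) natrM; lra.
Qed.

End Rules.

Theorem theorem3 (R : realType) :
  (exists c eps0 K : R, [/\ 0 < c, 0 < eps0, 0 < K &
     forall (m : nat) (eps delta : R),
       0 < eps <= eps0 -> 0 <= delta < 1 -> K <= (1 - delta) * ln m%:R ->
     exists n0 : nat, forall n : nat, (n0 <= n)%N ->
       let bound := c * (ln m%:R / eps ^+ 2 * (1 - delta)) in
       [/\ forall r : voting_rule {set 'I_m} n m, approval_rule r ->
             needs_samples r eps delta bound,
           forall r : voting_rule 'S_m n m, borda_rule r ->
             needs_samples r eps delta bound,
           forall r : voting_rule 'S_m n m, bucklin_rule r ->
             needs_samples r eps delta bound &
           forall r : voting_rule 'S_m n m, condorcet_consistent r ->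
             needs_samples r eps delta bound]])
  /\
  (forall gamma : R, 0 < gamma < 1 ->
   exists c eps0 K : R, [/\ 0 < c, 0 < eps0, 0 < K &
     forall (k m : nat) (eps delta : R),
       (0 < k)%N -> k%:R <= gamma * m%:R ->
       0 < eps <= eps0 -> 0 <= delta < 1 -> K <= (1 - delta) * ln k%:R ->
     exists n0 : nat, forall n : nat, (n0 <= n)%N ->
       forall r : voting_rule 'S_m n m, k_approval_rule k r ->
         needs_samples r eps delta
           (c * (ln k%:R / eps ^+ 2 * (1 - delta)))]).
Proof.
split.
  (* The tilt is [24 * eps], kept below 1 by [eps <= 1 / 100]; 8 is the threshold of
     [lower_bound_of_fano]. *)
  exists (1 / (8 * 24 ^+ 2)), (1 / 100), 8; split; [lra|lra|lra|].
  move=> m eps delta eps1 d1 K.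
  have [e0 _] := andP eps1; have [d0 dlt] := andP d1.
  have dle : delta <= 1 by exact: ltW.
  have lnm : 8 <= ln m%:R :> R by nra.
  have m9 : (9 <= m)%N.
    have p8 : 0 < 8 :> R by lra.
    by have := lt_of_ln p8 lnm; rewrite -(ler_nat R); lra.
  have lnm2 : ln m%:R <= 2 * ln m%:R :> R by lra.
  have [n1 H1] := approval_lower_bound (leq_trans (isT : 0 < 9)%N m9) eps1.
  have [n2 H2] := borda_lower_bound (leq_trans (isT : 1 < 9)%N m9) eps1.
  have l0 : (0 < m %/ 3)%N by lia.
  have l3 : (3 * (m %/ 3) <= m)%N by lia.
  have [n3 H3] := bucklin_lower_bound l0 l3 eps1.
  have [n4 H4] := condorcet_lower_bound (leq_trans (isT : 1 < 9)%N m9) eps1.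
  exists (maxn (maxn n1 n2) (maxn n3 n4)) => n.
  rewrite !geq_max => /andP[/andP[le1 le2] /andP[le3 le4]] /=.
  split=> r rule A sol.
  - apply: (lower_bound_of_fano _ e0 d1 lnm2 K) => //; exact: H1.
  - apply: (lower_bound_of_fano _ e0 d1 lnm2 K) => //; exact: H2.
  - apply: (lower_bound_of_fano _ e0 d1 _ K (H3 n le3 r rule delta A dle sol)) => //.
    (* Bucklin has only [2 * (m %/ 3)] competitors, but [m] is at most the square of this number, so
       the logarithm loses at most a factor 2. *)
    by apply: ln_le_double; [lia|lia|nia].
  - apply: (lower_bound_of_fano _ e0 d1 lnm2 K) => //; exact: H4.
move=> gamma /andP[g0 g1].
(* The tilt is [A * eps], at most 1 when [eps <= (1 - gamma) / 16], and its product with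
   [(1 - gamma) / 4] is [4 * eps]. *)
pose A : R := 16 / (1 - gamma).
have A0 : 0 < A by rewrite divr_gt0// subr_gt0.
exists (1 / (8 * A ^+ 2)), ((1 - gamma) / 16), 8; split.
- by rewrite divr_gt0// mulr_gt0// exprn_gt0.
- by rewrite divr_gt0// subr_gt0.
- by [].
move=> k m eps delta k0 km /andP[e0 e1] d1 K.
have [d0 dlt] := andP d1; have dle : delta <= 1 by exact: ltW.
have lnk : 8 <= ln k%:R :> R by nra.
have kR : 1 <= k%:R :> R by rewrite ler1n.
have mR : 0 < m%:R :> R by nra.
have ltkm : (k < m)%N by rewrite -(ltr_nat R); nra.
pose p := minn m (2 * k).
have kp : (k < p)%N by rewrite leq_min ltkm ltn_Pmull.
have pm : (p <= m)%N by exact: geq_minl.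
have p2k : (p <= 2 * k)%N by exact: geq_minr.
have pR : 0 < p%:R :> R by rewrite ltr0n (leq_trans _ kp).
have a1 : 0 <= A * eps <= 1.
  rewrite mulr_ge0 ?(ltW A0) ?(ltW e0)//= /A mulrAC ler_pdivrMr; lra.
(* If [p = m], the ratio lies between 1/2 and [gamma]; if [p = 2 * k], it is exactly 1/2. *)
have etaP : (1 - gamma) / 4 <= k%:R / p%:R * (1 - k%:R / p%:R).
  have [pE|pE] : p = m \/ p = (2 * k)%N 
    by rewrite /p; case: leqP; [left|right].
    have th1 : 1 / 2 <= k%:R / p%:R :> R.
      by rewrite ler_pdivlMr// -(ler_nat R) natrM in p2k *; lra.
    have th2 : k%:R / p%:R <= gamma by rewrite ler_pdivrMr// pE.
    nra.
  have -> : k%:R / p%:R = 1 / 2 :> R by rewrite pE natrM; field; lra.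
  lra.
have gap : 2 * eps < A * eps * ((1 - gamma) / 4).
  have -> : A * eps * ((1 - gamma) / 4) = 4 * eps by rewrite /A; field; lra.
  lra.
have e4 : 0 < eps < 1 / 4 by apply/andP; split; lra.
have [n0 Hn0] := k_approval_lower_bound
  (introT andP (conj k0 kp)) pm p2k e4 a1 erefl etaP gap.
exists n0 => n le r rule alg sol.
apply: (lower_bound_of_fano A0 e0 d1 _ K (Hn0 n le r rule delta alg dle sol)).
have : ln k%:R <= ln p%:R :> R.
  by rewrite ler_ln ?posrE//; [rewrite ler_nat ltnW|lra].
lra.
Qed.
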